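(* Let $A$ be a proper unital $*$-ring such that $A_\Sigma\cap-A_\Sigma=\{0\}$. (1) If $A_+\subseteq B\subseteq A$, then $B$ is a $\ll$-semilattice. (2) If $A^1_+\subseteq B\subseteq\tfrac12\mathfrak{F}$, then $B$ is a $\ll$-lattice. (3) If $2$ is invertible in $A$ and $A^1_+\subseteq B\subseteq\mathfrak{B}$, then $B$ is a $\ll$-lattice.
   Context: A $*$-ring is an associative ring with a map $a\mapsto a^*$ satisfying $a^{**}=a$, $(ab)^*=b^*a^*$, $(a+b)^*=a^*+b^*$; it is proper if $a^*a=0$ implies $a=0$. Unital means having a two-sided unit $1$. $A_{\mathrm{sa}}=\{a\in A:a=a^*\}$. $A_\Sigma$ is the set of all finite sums $\sum_{k=1}^n a_k^*a_k$ with $n\geq1$, $a_k\in A$. $A_+=\{a\in A:na\in A_\Sigma\text{ for some positive integer }n\}$. $\mathfrak{r}=\{a\in A:a+a^*\in A_+\}$, and $a\preceq b$ means $b-a\in\mathfrak{r}$. $\mathfrak{B}=\{a\in A:a^*a\preceq1\}$, $\tfrac12\mathfrak{F}=\{a\in A:a^*a\preceq a\}$, $A^1_+=\tfrac12\mathfrak{F}\cap A_{\mathrm{sa}}$. The relation $\ll$ is $a\ll b\Leftrightarrow a=ab$. For a set $B$ with the (restricted) relation $\ll$ and $F\subseteq B$, an element $a\in B$ is a $\ll$-supremum of $F$ if $\{c\in B:a\ll c\}=\bigcap_{b\in F}\{c\in B:b\ll c\}$, and a $\ll$-infimum of $F$ if $\{c\in B:c\ll a\}=\bigcap_{b\in F}\{c\in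 B:c\ll b\}$ (neither uniqueness nor reflexivity of $\ll$ is required). $B$ is a $\ll$-semilattice if every non-empty finite $F\subseteq B$ has a $\ll$-supremum in $B$; $B$ is a $\ll$-lattice if every non-empty finite $F\subseteq B$ has both a $\ll$-supremum and a $\ll$-infimum in $B$. *)

(* Defs.v *)
From HB Require Import structures.
From mathcomp Require Import all_boot all_algebra.
From mathcomp Require Import boolp classical_sets functions cardinality.

Set Implicit Arguments.
Unset Strict Implicit.
Unset Printing Implicit Defensive.

Import GRing.Theory.
Local Open Scope classical_set_scope.
Local Open Scope ring_scope.

(* The base structure is pzRingType, so that the zero ring is a unital *-ring. *)
HB.mixin Record PzRing_isStarRing (A : Type) of GRing.PzRing A := {
  star : A -> A;
  starK : forall a : A, star (star a) = a;
  starM : forall a b : A, star (a * b) = star b * star a;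
  starD : forall a b : A, star (a + b) = star a + star b
}.

#[short(type="starRingType")]
HB.structure Definition StarRing :=
  { A of GRing.PzRing A & PzRing_isStarRing A }.

Section StarRingDefs.
Context {A : starRingType}.
Implicit Types (a b : A) (B F : set A).

Definition invertible a := exists b, b * a = 1 /\ a * b = 1.

Definition selfadjoint : set A := [set a | a = star a].

(* A_Sigma *)
Definition square_sums : set A :=
  [set a | exists n : nat, (0 < n)%N /\
     exists u : 'I_n -> A, a = \sum_(k < n) star (u k) * u k].

(* A_+ *)
Definition positives : set A :=
  [set a | exists n : nat, (0 < n)%N /\ square_sums (a *+ n)].

(* The set r of accretive elements; they need not be selfadjoint. *)
Definition accretive : set A := [set a | positives (a + star a)].

Definition preceq a b : Prop := accretive (b - a).

(* The set B (fraktur) *)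
Definition contractions : set A := [set a | preceq (star a * a) 1].

(* The set (1/2)F (fraktur): the factor 1/2 is purely notational, 2 need not
   be invertible. *)
Definition halfF : set A := [set a | preceq (star a * a) a].

(* A^1_+ *)
Definition unit_positives : set A := halfF `&` selfadjoint.

Definition ll a b : Prop := a = a * b.

(* As ll need not be reflexive, suprema and infima are defined by their sets of
   bounds and need not be bounds themselves, nor be unique. *)
Definition ll_supremum B F a : Prop :=
  B a /\ [set c | B c /\ ll a c] = \bigcap_(b in F) [set c | B c /\ ll b c].

Definition ll_infimum B F a : Prop :=
  B a /\ [set c | B c /\ ll c a] = \bigcap_(b in F) [set c | B c /\ ll c b].

Definition ll_semilattice B : Prop :=
  forall F, F `<=` B -> F !=set0 -> finite_set F ->
    exists a, ll_supremum B F a.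

Definition ll_lattice B : Prop :=
  forall F, F `<=` B -> F !=set0 -> finite_set F ->
    (exists a, ll_supremum B F a) /\ (exists a, ll_infimum B F a).

End StarRingDefs.

Definition proper_star_ring (A : starRingType) : Prop :=
  forall a : A, star a * a = 0 -> a = 0.

(* Main.v *)
Require Import Defs.
From HB Require Import structures.
From mathcomp Require Import all_boot all_algebra.
From mathcomp Require Import boolp classical_sets functions cardinality.

Set Implicit Arguments.
Unset Strict Implicit.
Unset Printing Implicit Defensive.

Import GRing.Theory.
Local Open Scope classical_set_scope.
Local Open Scope ring_scope.

(** Since [a = a * c] means [a * (1 - c) = 0], suprema are a matter of the
    right annihilators of the elements [a], and infima a matter of the left
    annihilators of the elements [1 - a]. The involution exchanges both sides.

    The cone condition and properness make the additive group torsion-free and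
    force [x * d = 0] as soon as [star d * x * d = 0] with [x] in [A_+]
    (lemma [positives_mulr_eq0]). Hence the right annihilator of a sum of
    positive elements is the intersection of their right annihilators
    ([positivesD_mulr_eq0]), and [\sum star a * a] is a supremum for the
    semilattice part.

    Such a sum leaves the unit interval, so for the lattice parts two elements
    [s] and [p = star a * a] of [A^1_+] are combined into
    [1 - (1 - s) * (1 - p) * (1 - s)] instead. It lies in [A^1_+]
    ([unit_positives_sandwich]), and equals [s], plus something positive, plus
    [(1 - s) * p * (1 - s)], so it kills [d] exactly when [s] and then [a] do
    ([contractions_join]).

    For infima the same construction is applied to the adjoints of contractions
    [h b] with the left annihilator of [1 - b], and subtracted from [1]. One
    takes [h b = 1 - b] if [b] is in [halfF], since [halfF] is stable under
    subtraction from [1] and consists of contractions ([halfF_contractions]),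
    and [h b = (1 - b) / 2] if [b] is only a contraction. *)

Section StarRing.
Context {A : starRingType}.
Implicit Types (a b c d s x y : A) (l : seq A) (B : set A).

Fact star_zmod_morphism : zmod_morphism (@star A).
Proof.
move=> a b; apply: (addIr (star b)).
by rewrite -starD !subrK.
Qed.

HB.instance Definition _ :=
  GRing.isZmodMorphism.Build A A (@star A) star_zmod_morphism.

Lemma star1 : star (1 : A) = 1.
Proof. by rewrite -[LHS]mul1r -{1}[1]starK -starM mul1r starK. Qed.

Lemma star_eq0 a : star a = 0 <-> a = 0.
Proof.
split=> [h|->]; last exact: raddf0.
by rewrite -[a]starK h raddf0.
Qed.

Lemma star_square a : star (star a * a) = star a * a.
Proof. by rewrite starM starK. Qed.

(** * The cone of positive elements *)

Lemma square_sumsP x :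
  square_sums x <-> exists l : seq A, x = \sum_(u <- l) star u * u.
Proof.
split=> [[n [_ [u ->]]]|[l ->]].
  by exists [seq u k | k <- enum 'I_n]; rewrite big_map big_enum.
(* The leading 0 provides the nonempty index set that the definition requires. *)
exists (size (0 :: l)); split=> //; exists (tnth (in_tuple (0 :: l))).
by rewrite -(big_tnth _ _ _ xpredT (fun u => star u * u)) big_cons mulr0 add0r.
Qed.

Lemma square_sums0 : square_sums (0 : A).
Proof. by apply/square_sumsP; exists [::]; rewrite big_nil. Qed.

Lemma square_sums_square a : square_sums (star a * a).
Proof. by apply/square_sumsP; exists [:: a]; rewrite big_seq1. Qed.

Lemma square_sumsD x y : square_sums x -> square_sums y -> square_sums (x + y).
Proof.
move=> /square_sumsP[l ->] /square_sumsP[m ->].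
by apply/square_sumsP; exists (l ++ m); rewrite big_cat.
Qed.

Lemma square_sumsMn x n : square_sums x -> square_sums (x *+ n).
Proof.
move=> hx; elim: n => [|n IHn]; first by rewrite mulr0n; exact: square_sums0.
by rewrite mulrS; exact: square_sumsD.
Qed.

Lemma square_sums_conj d x : square_sums x -> square_sums (star d * x * d).
Proof.
move=> /square_sumsP[l ->]; apply/square_sumsP; exists [seq u * d | u <- l].
rewrite big_map mulr_sumr mulr_suml.
by apply: eq_bigr => u _; rewrite starM !mulrA.
Qed.

Lemma square_sums_positives x : square_sums x -> positives x.
Proof. by exists 1%N. Qed.

Lemma positives_square a : positives (star a * a).
Proof. exact/square_sums_positives/square_sums_square. Qed.

Lemma positivesD x y : positives x -> positives y -> positives (x + y).
Proof.
move=> [m [m0 hx]] [n [n0 hy]]; exists (m * n)%N; rewrite muln_gt0 m0 n0.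
split=> //; rewrite mulrnDl; apply: square_sumsD.
  by rewrite mulrnA; exact: square_sumsMn.
by rewrite mulnC mulrnA; exact: square_sumsMn.
Qed.

Lemma positives_conj d x : positives x -> positives (star d * x * d).
Proof.
move=> [n [n0 hx]]; exists n; split=> //.
by rewrite -mulrnAl -mulrnAr; exact: square_sums_conj.
Qed.

Lemma positivesMn x n : (0 < n)%N -> positives (x *+ n) <-> positives x.
Proof.
move=> n0; split=> -[m [m0 hx]].
  by exists (n * m)%N; rewrite muln_gt0 n0 m0 mulrnA.
by exists m; split=> //; rewrite -mulrnA mulnC mulrnA; exact: square_sumsMn.
Qed.

(** * Contractions and the unit interval *)

Lemma contractionsP a : contractions a <-> positives (1 - star a * a).
Proof.
rewrite /contractions /= /preceq /accretive /= raddfB /= star1 star_square.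
by rewrite -mulr2n; exact: positivesMn.
Qed.

Lemma unit_positivesP s :
  unit_positives s <-> star s = s /\ positives (s * (1 - s)).
Proof.
have E : star s = s -> halfF s <-> positives (s * (1 - s)).
  move=> hs; rewrite /halfF /= /preceq /accretive /= raddfB /= star_square hs.
  by rewrite -mulr2n mulrBr mulr1; exact: positivesMn.
split=> [[hF /= /esym hs]|[hs hp]]; first by split=> //; apply/(E hs).
by split; [apply/(E hs)|rewrite /selfadjoint /= hs].
Qed.

Lemma unit_positives_positives s : unit_positives s -> positives s.
Proof.
move=> /unit_positivesP[hs hp].
have -> : s = star s * s + s * (1 - s) by rewrite hs mulrBr mulr1 addrC subrK.
by apply: positivesD hp; exact: positives_square.
Qed.

Lemma unit_positivesC s : unit_positives s -> unit_positives (1 - s).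
Proof.
move=> /unit_positivesP[hs hp]; apply/unit_positivesP; split.
  by rewrite raddfB /= star1 hs.
by rewrite subKr mulrBl mul1r -{1}[s]mulr1 -mulrBr.
Qed.

(** The element [1 - a * star a] is
    [star (1 - a * star a) * (1 - a * star a) + a * (1 - star a * a) * star a],
    so no spectral argument is needed. *)
Lemma contractions_star a : contractions a -> contractions (star a).
Proof.
move=> /contractionsP ha; apply/contractionsP; rewrite starK.
set p := a * star a.
have hp : star p = p by rewrite starM starK.
have -> : 1 - p = star (1 - p) * (1 - p) + p * (1 - p).
  by rewrite raddfB /= star1 hp -mulrDl subrK mul1r.
apply: positivesD; first exact: positives_square.
have -> : p * (1 - p) = star (star a) * (1 - star a * a) * star a.
  by rewrite starK !mulrBr mulrBl !mulr1 /p !mulrA.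
exact: positives_conj.
Qed.

(** [p * (1 - p)] is [star a * (1 - a * star a) * a] for [p = star a * a], whence
    the passage to the adjoint contraction. *)
Lemma unit_positives_square a :
  contractions a -> unit_positives (star a * a).
Proof.
move=> /contractions_star/contractionsP; rewrite starK => ha.
apply/unit_positivesP; split; first exact: star_square.
have -> : star a * a * (1 - star a * a) = star a * (1 - a * star a) * a.
  by rewrite !mulrBr mulrBl !mulr1 !mulrA.
exact: positives_conj.
Qed.

(** Here [1 - star a * a] is the square [star (1 - a) * (1 - a)] plus
    [a - star a * a] and its adjoint. *)
Lemma halfF_contractions : halfF `<=` (@contractions A).
Proof.
move=> a; rewrite /halfF /= /preceq /accretive /= raddfB /= star_square => ha.
apply/contractionsP.
have -> : 1 - star a * a =
    star (1 - a) * (1 - a) + (a - star a * a + (star a - star a * a)).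
  rewrite raddfB /= star1 mulrBl mul1r mulrBr mulr1 addrACA.
  rewrite [_ - _ + (a - _)]addrA subrK opprB.
  by rewrite [star a * a - star a + _]addrA subrK subrr addr0.
by apply: positivesD ha; exact: positives_square.
Qed.

Lemma halfFC a : halfF a -> halfF (1 - a).
Proof.
rewrite /halfF /= /preceq /accretive /= => ha.
have E : 1 - a - star (1 - a) * (1 - a) = star (a - star a * a).
  rewrite !raddfB /= star1 star_square -{1}[1 - a]mul1r -mulrBl subKr.
  by rewrite mulrBr mulr1.
by rewrite E starK addrC.
Qed.

(** By the parallelogram law, [4 * (1 - star h * h)] is
    [2 * (1 - star a * a) + star (1 + a) * (1 + a)]. *)
Lemma contractions_half a h :
  contractions a -> h *+ 2 = 1 - a -> contractions h.
Proof.
move=> /contractionsP ha hE; apply/contractionsP.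
apply/(@positivesMn _ 4) => //.
have -> : (1 - star h * h) *+ 4 =
    (1 - star a * a) *+ 2 + star (1 + a) * (1 + a).
  have -> : (1 - star h * h) *+ 4 = 1 *+ 4 - star (1 - a) * (1 - a).
    by rewrite -hE raddfMn mulrnBl mulrnAl mulrnAr -mulrnA.
  apply/eqP; rewrite subr_eq -addrA; apply/eqP.
  have -> : star (1 + a) * (1 + a) + star (1 - a) * (1 - a) =
      (1 + star a * a) *+ 2.
    rewrite starD raddfB /= star1 [_ * (1 + a)]mulrDl [_ * (1 - a)]mulrBl.
    rewrite !mul1r.
    rewrite addrACA -mulrBr [1 - a in X in _ + X]addrC opprD opprK.
    rewrite [1 + a + (a - 1)]addrC subrKA addrACA subrr addr0.
    by rewrite mulrDr addrACA.
  by rewrite -(mulrnDl _ _ _) addrACA addNr addr0 -[1 + 1]mulr2n -mulrnA.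
by apply: positivesD; [apply/positivesMn|exact: positives_square].
Qed.

(** With [x = 1 - s], [q = 1 - p] and [r = x * q * x], the product
    [r * (1 - r)] is the conjugate by [x] of
    [q * (1 - q) + q * (1 - x * x) * q]. *)
Lemma unit_positives_sandwich s p :
  unit_positives s -> unit_positives p ->
  unit_positives (1 - (1 - s) * (1 - p) * (1 - s)).
Proof.
move=> /unit_positivesC hx /unit_positivesC hq; apply: unit_positivesC.
move: (1 - s) (1 - p) hx hq => x q hx.
have h1x := unit_positives_positives (unit_positivesC hx).
move: hx => /unit_positivesP[xx hx] /unit_positivesP[qq hq].
apply/unit_positivesP; split; first by rewrite !starM xx qq mulrA.
have -> : x * q * x * (1 - x * q * x) =
    star x * (q * (1 - q) + star q * (1 - x + x * (1 - x)) * q) * x.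
  rewrite xx qq [x * (1 - x)]mulrBr mulr1 [1 - x + _]addrA subrK.
  rewrite -[q * _ * q]mulrA -mulrDr [(1 - x * x) * q]mulrBl mul1r.
  rewrite [1 - q + _]addrA subrK !mulrBr !mulr1 mulrBl.
  by rewrite !mulrA.
apply: positives_conj; apply: positivesD => //; apply: positives_conj.
exact: positivesD.
Qed.

(** * Annihilators of positive elements *)

Section Annihilators.
Context (A_proper : proper_star_ring A).
Context (A_cone :
  (@square_sums A) `&` [set - a | a in @square_sums A] = [set 0]).

Lemma square_sums_add_eq0 x y :
  square_sums x -> square_sums y -> x + y = 0 -> x = 0.
Proof.
move=> hx hy /eqP; rewrite addr_eq0 => /eqP xy.
have : (square_sums `&` [set - a | a in square_sums]) x.
  by split=> //; exists y.
by rewrite A_cone.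
Qed.

(** If [x *+ n.+1 = 0] then [star x * x] and [(star x * x) *+ n] are opposite sums
    of squares. *)
Lemma mulrn_eq0_torsion_free x n : (0 < n)%N -> x *+ n = 0 <-> x = 0.
Proof.
case: n => // n _; split=> [xn|->]; last exact: mul0rn.
apply: A_proper.
apply: (square_sums_add_eq0 (square_sums_square x)
         (square_sumsMn n (square_sums_square x))).
by rewrite -mulrS -mulrnAr xn mulr0.
Qed.

Lemma positives_add_eq0 x y :
  positives x -> positives y -> x + y = 0 -> x = 0.
Proof.
move=> [m [m0 hx]] [n [n0 hy]] xy.
have mn0 : (0 < m * n)%N by rewrite muln_gt0 m0.
apply/(mulrn_eq0_torsion_free _ mn0).
apply: (@square_sums_add_eq0 _ (y *+ (m * n))).
- by rewrite mulrnA; exact: square_sumsMn.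
- by rewrite mulnC mulrnA; exact: square_sumsMn.
- by rewrite -mulrnDl xy mul0rn.
Qed.

Lemma square_mulr_eq0 a d : star a * a * d = 0 <-> a * d = 0.
Proof.
split=> [ad|ad]; last by rewrite -mulrA ad mulr0.
by apply: A_proper; rewrite starM -mulrA (mulrA (star a)) ad mulr0.
Qed.

(** A multiple of [x] is a sum of squares [star u * u]; then
    [star d * x * d = 0] makes the sum of the [star (u * d) * (u * d)] vanish,
    hence each [u * d]. *)
Lemma positives_mulr_eq0 x d :
  positives x -> star d * x * d = 0 -> x * d = 0.
Proof.
move=> [n [n0 /square_sumsP[l xE]]] xd.
apply/(mulrn_eq0_torsion_free _ n0); rewrite -mulrnAl.
have : star d * (x *+ n) * d = 0 by rewrite mulrnAr mulrnAl xd mul0rn.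
rewrite {}xE {xd n0 x n}; elim: l => [|u l IHl].
  by rewrite big_nil mul0r.
rewrite big_cons !(mulrDr, mulrDl) => e.
have hu := positives_conj d (positives_square u).
have hl : positives (star d * (\sum_(v <- l) star v * v) * d).
  by apply/positives_conj/square_sums_positives/square_sumsP; exists l.
have u0 := positives_add_eq0 hu hl e.
rewrite u0 add0r in e; rewrite (IHl e) addr0.
apply/square_mulr_eq0; apply: A_proper.
by rewrite starM -u0 !mulrA.
Qed.

Lemma positivesD_mulr_eq0 x y d :
  positives x -> positives y ->
  (x + y) * d = 0 <-> x * d = 0 /\ y * d = 0.
Proof.
move=> hx hy; split=> [e|[xd yd]]; last by rewrite mulrDl xd yd addr0.
have xd : x * d = 0.
  apply: positives_mulr_eq0 => //.
  apply: (positives_add_eq0 (positives_conj d hx) (positives_conj d hy)).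
  by rewrite -mulrDl -mulrDr -mulrA e mulr0.
by split=> //; move: e; rewrite mulrDl xd add0r.
Qed.

(** * Suprema and infima *)

Lemma llE a c : ll a c <-> a * (1 - c) = 0.
Proof.
rewrite /ll mulrBr mulr1; split=> [{1}->|/eqP]; first by rewrite subrr.
by rewrite subr_eq0 => /eqP.
Qed.

Lemma positives_join l :
  exists2 s, positives s &
    forall d, s * d = 0 <-> {in l, forall a, a * d = 0}.
Proof.
elim: l => [|a l [s hs sP]].
  exists 0; first exact/square_sums_positives/square_sums0.
  by move=> d; rewrite mul0r.
exists (star a * a + s).
  by apply: positivesD => //; exact: positives_square.
move=> d; split.
  move=> /(positivesD_mulr_eq0 _ (positives_square a) hs)[].
  move=> /square_mulr_eq0 ad /sP ld b; rewrite inE => /orP[/eqP->//|].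
  exact: ld.
move=> ald; apply/positivesD_mulr_eq0 => //; first exact: positives_square.
split; first by apply/square_mulr_eq0/ald; rewrite mem_head.
by apply/sP => b bl; apply: ald; rewrite inE bl orbT.
Qed.

(** In contrast with [positives_join] the annihilating element stays in the unit
    interval. Once [s * d = 0], the factor [1 - s] fixes [d], so that
    [a * (1 - s) * d = 0] says [a * d = 0]. *)
Lemma contractions_join l :
  {in l, forall a, contractions a} ->
  exists2 s, unit_positives s &
    forall d, s * d = 0 <-> {in l, forall a, a * d = 0}.
Proof.
elim: l => [_|a l IHl lB].
  exists 0; last by move=> d; rewrite mul0r.
  apply/unit_positivesP; rewrite raddf0 mul0r; split=> //.
  exact/square_sums_positives/square_sums0.
have [|s hs sP] := IHl; first by move=> b bl; apply: lB; rewrite inE bl orbT.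
have ha := lB a (mem_head _ _).
exists (1 - (1 - s) * (1 - star a * a) * (1 - s)).
  by apply: unit_positives_sandwich => //; exact: unit_positives_square.
have ps := unit_positives_positives hs.
move: hs => /unit_positivesP[ss hs].
have -> : 1 - (1 - s) * (1 - star a * a) * (1 - s) =
    s + ((1 - s) * s + star (a * (1 - s)) * (a * (1 - s))).
  have E : 1 - (1 - s) * (1 - s) = s + (1 - s) * s.
    by rewrite [X in 1 - X]mulrBr mulr1 opprB addrCA subKr addrC.
  rewrite starM raddfB /= star1 ss [(1 - s) * (1 - star a * a)]mulrBr mulr1.
  by rewrite mulrBl opprB addrCA E addrC -addrA !mulrA.
have hC : positives ((1 - s) * s).
  by rewrite mulrBl mul1r -{1}[s]mulr1 -mulrBr.
have hT := positivesD hC (positives_square (a * (1 - s))).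
move=> d; split.
  move=> /(positivesD_mulr_eq0 _ ps hT)[sd].
  move=> /(positivesD_mulr_eq0 _ hC (positives_square _))[_].
  move=> /square_mulr_eq0; rewrite -mulrA mulrBl mul1r sd subr0 => ad.
  move=> b; rewrite inE => /orP[/eqP->//|].
  by move: b; apply/sP.
move=> ald.
have sd : s * d = 0.
  by apply/sP => b bl; apply: ald; rewrite inE bl orbT.
apply/(positivesD_mulr_eq0 _ ps hT); split=> //.
apply/(positivesD_mulr_eq0 _ hC (positives_square _)).
split; first by rewrite -mulrA sd mulr0.
apply/square_mulr_eq0.
by rewrite -mulrA mulrBl mul1r sd subr0 ald ?mem_head.
Qed.

(** Nonemptiness confines the common bounds to [B]. *)
Lemma ll_supremum_seq B l s :
  B s -> (forall d, s * d = 0 <-> {in l, forall a, a * d = 0}) ->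
  [set` l] !=set0 -> ll_supremum B [set` l] s.
Proof.
move=> Bs sP [a0 a0l]; split=> //; apply/seteqP; split=> c.
  by move=> [Bc /llE/sP lc] a al; split=> //; apply/llE/lc.
move=> lc; have [Bc _] := lc a0 a0l.
by split=> //; apply/llE/sP => a al; apply/llE; have [] := lc a al.
Qed.

Lemma ll_infimum_seq B l s :
  B s -> (forall c, c * (1 - s) = 0 <-> {in l, forall a, c * (1 - a) = 0}) ->
  [set` l] !=set0 -> ll_infimum B [set` l] s.
Proof.
move=> Bs sP [a0 a0l]; split=> //; apply/seteqP; split=> c.
  by move=> [Bc /llE/sP lc] a al; split=> //; apply/llE/lc.
move=> lc; have [Bc _] := lc a0 a0l.
by split=> //; apply/llE/sP => a al; apply/llE; have [] := lc a al.
Qed.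

Lemma ll_semilattice_above_positives B : positives `<=` B -> ll_semilattice B.
Proof.
move=> posB F _ F0 /finite_seqP[l FE]; rewrite FE in F0 *.
have [s hs sP] := positives_join l.
by exists s; apply: ll_supremum_seq => //; exact: posB.
Qed.

(** The function [h] replaces the elements [1 - b], which need not be
    contractions, by contractions with the same left annihilator. *)
Lemma ll_lattice_of_contractions B (h : A -> A) :
  unit_positives `<=` B -> B `<=` contractions ->
  (forall b, B b -> contractions (h b)) ->
  (forall b c, B b -> c * (1 - b) = 0 <-> c * h b = 0) ->
  ll_lattice B.
Proof.
move=> unitB Bcontr hcontr hP F FB F0 /finite_seqP[l FE].
rewrite FE in FB F0 *; split.
  have [|s hs sP] := @contractions_join l; first by move=> b /FB/Bcontr.
  by exists s; apply: ll_supremum_seq => //; exact: unitB.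
have [|s hs sP] := @contractions_join [seq star (h b) | b <- l].
  by move=> _ /mapP[b /FB Bb ->]; exact/contractions_star/hcontr.
exists (1 - s); apply: ll_infimum_seq => //.
  exact/unitB/unit_positivesC.
move: hs => /unit_positivesP[ss _] c; rewrite subKr.
have -> : c * s = star (s * star c) by rewrite starM starK ss.
split=> [/star_eq0/sP ld b bl|lc].
  apply/(hP _ _ (FB _ bl))/star_eq0; rewrite starM; apply: ld.
  exact: map_f.
apply/star_eq0/sP => _ /mapP[b bl ->].
by rewrite -starM; apply/star_eq0/(hP _ _ (FB _ bl))/lc.
Qed.

End Annihilators.
End StarRing.

Theorem mainTheorem7 (A : starRingType)
  (A_proper : proper_star_ring A)
  (A_cone : (@square_sums A) `&` [set - a | a in @square_sums A] = [set 0]) :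
  [/\ forall B : set A,
        positives `<=` B -> B `<=` setT -> ll_semilattice B,
      forall B : set A,
        unit_positives `<=` B -> B `<=` halfF -> ll_lattice B
    & invertible (2 : A) ->
      forall B : set A,
        unit_positives `<=` B -> B `<=` contractions -> ll_lattice B].
Proof.
split=> [B posB _|B unitB BF|[t [_ t2]] B unitB Bcontr].
- exact: ll_semilattice_above_positives.
- apply: (ll_lattice_of_contractions A_proper A_cone (h := fun b => 1 - b)) => //.
    exact: subset_trans halfF_contractions.
  by move=> b /BF/halfFC/halfF_contractions.
have h2 b : (t * (1 - b)) *+ 2 = 1 - b.
  by rewrite -mulr_natl mulrA t2 mul1r.
apply: (ll_lattice_of_contractions A_proper A_cone
         (h := fun b => t * (1 - b))) => // [b /Bcontr hb|b c _].
  exact: contractions_half hb (h2 b).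
by rewrite -{1}(h2 b) mulrnAr; exact: mulrn_eq0_torsion_free.
Qed.
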